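(* Let $m, s_1, \dots, s_m \in \mathbb{N}_0$, $s_{m+1} \in \mathbb{N}$. Then for any positive integer $n$, $$H_n^*[\{2\}^{s_1}, 1, \dots, \{2\}^{s_m}, 1, \{2\}^{s_{m+1}}] = - \sum_{\mathbf{p}=(2s_1+1)\circ\dots\circ(2s_m+1)\circ(2s_{m+1})} \overline{\mathcal{H}}_n[\mathbf{p}; \widetilde{\mathbf{p}}],$$ where $\circ$ is either comma or plus, and the string $\widetilde{\mathbf{p}} := (s_1+1) \circ \dots \circ (s_m+1) \circ (s_{m+1})$ is associated with the string $\mathbf{p}$, i.e. the choice of commas and pluses in $\mathbf{p}$ and $\widetilde{\mathbf{p}}$ is the same.
   Context: Let $0<q<1$, $[n]_q = \frac{1-q^n}{1-q}$, $(q)_n=\prod_{k=0}^{n-1}(1-q^{k+1})$, and $\begin{bmatrix} n \\ m \end{bmatrix} = \frac{(q)_n}{(q)_m (q)_{n-m}}$ for $0\le m\le n$, $0$ otherwise. $H_n^*[s_1,\dots,s_m] = \sum_{n \geq k_1 \geq \dots \geq k_m \geq 1} \prod_{j=1}^m \frac{q^{k_j}}{[k_j]_q^{s_j}}$ with $H_n^*[\emptyset]=1$. For $m\ge0$, $\mathbf{s},\mathbf{t}\in\mathbb{Z}^m$, $\overline{\mathcal{H}}_n[\mathbf{s}; \mathbf{t}] = \sum_{n \geq k_1 > \dots > k_m \geq 1} (-1)^{k_m} \frac{\begin{bmatrix} n \\ k_1 \end{bmatrix}}{\begin{bmatrix} n+k_1 \\ k_1 \end{bmatrix}} q^{k_1^2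 - k_m(k_m-1)/2} \prod_{j=1}^m \frac{(1+q^{k_j})q^{(t_j-1)k_j}}{[k_j]_q^{s_j}}$, with $\overline{\mathcal{H}}_n=0$ if $n<m$ and $=1$ if $m=0$. $\{2\}^a$ denotes $a$ consecutive 2's. *)

(* Defs.v *)
From HB Require Import structures.
From mathcomp Require Import all_boot all_order all_algebra.

Set Implicit Arguments.
Unset Strict Implicit.
Unset Printing Implicit Defensive.

Import Order.TTheory GRing.Theory Num.Theory.
Local Open Scope ring_scope.

Definition qnum (R : fieldType) (q : R) (n : nat) : R := (1 - q ^+ n) / (1 - q).

Definition qpoch (R : fieldType) (q : R) (n : nat) : R :=
  \prod_(k < n) (1 - q ^+ k.+1).

Definition qbinom (R : fieldType) (q : R) (n m : nat) : R :=
  if (m <= n)%N then qpoch q n / (qpoch q m * qpoch q (n - m)) else 0.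

(* In both sums the tuple (k_1, ..., k_m) is 0-indexed: k_(j+1) is tnth k j. *)

Definition Hstar (R : fieldType) (q : R) (n : nat) (s : seq int) : R :=
  \sum_(k : (size s).-tuple 'I_n.+1
        | sorted geq (map val k) && all (fun i : 'I_n.+1 => 0 < i)%N k)
     \prod_(j < size s) (q ^+ tnth k j / qnum q (tnth k j) ^ s`_j).

(* s and t are meant to have the same length m. The convention that the value
   is 0 when n < m needs no clause, the sum being empty in that case; the case
   m = 0 does, as the summand mentions k_1 and k_m (head and last below, whose
   default ord0 is irrelevant for m > 0). *)
Definition Hbar (R : fieldType) (q : R) (n : nat) (s t : seq int) : R :=
  if size s == 0%N then 1 else
  \sum_(k : (size s).-tuple 'I_n.+1
        | sorted gtn (map val k) && all (fun i : 'I_n.+1 => 0 < i)%N k)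
     let k1 : nat := head ord0 k in
     let km : nat := last ord0 k in
     (-1) ^+ km * (qbinom q n k1 / qbinom q (n + k1) k1)
     * q ^ ((k1 ^ 2)%N%:Z - ((km * km.-1) %/ 2)%N%:Z)
     * \prod_(j < size s)
         ((1 + q ^+ tnth k j) * q ^ ((t`_j - 1) * (tnth k j : nat)%:Z)
          / qnum q (tnth k j) ^ s`_j).

(* The string x_1 o x_2 o ... o x_(m+1), where the i-th separator is a comma if
   the i-th entry of c is true and a plus if it is false (size c = m). *)
Fixpoint circ (c : seq bool) (x : seq int) : seq int :=
  match c, x with
  | b :: c', a :: x' =>
      let y := circ c' x' in
      if b then a :: y else (a + head 0 y) :: behead y
  | _, _ => x
  end.

(* Main.v *)
Require Import Defs.
From HB Require Import structures.
From mathcomp Require Import all_boot all_order all_algebra.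
From mathcomp Require Import ring zify.

(** Both sides are sums over the largest index [k_1 = k] of the kernel
    [c(n,k) = binom(n,k) / binom(n+k,k)]: one shows
      [H*_n[w] = - sum_(k=1)^n c(n,k) q^(k^2) G_w(k)]
    by induction on the string [w] and on [n], where [G_w] does not depend on
    [n].  The base case [w = empty] (for [n >= 1]) telescopes.  Since
    [c(n,k) - c(n-1,k) = c(n,k) q^(n-k) [k]^2 / [n]^2], prepending a 2 to [w]
    multiplies [G_w(k)] by [q^k / [k]^2]; prepending a 1 replaces it by
    [(q^k G_w(k) + (1 + q^k) sum_(j<k) G_w(j)) / [k]], by another telescoping
    sum.  The two summands in the latter correspond to the choices plus and
    comma of the first separator, so [G_w] is the sum over all choices. *)

Set Implicit Arguments.
Unset Strict Implicit.
Unset Printing Implicit Defensive.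

Import Order.TTheory GRing.Theory Num.Theory.
Local Open Scope ring_scope.

(** * Sums over tuples, split by the first entry *)

Section TupleSums.
Variables (R : pzSemiRingType) (T : finType).

Lemma sum_tuple0 (P : pred (seq T)) (F : seq T -> R) :
  \sum_(k : 0.-tuple T | P k) F k = if P [::] then F [::] else 0.
Proof.
by case: ifP => P0; [rewrite (big_pred1 [tuple]) | rewrite big_pred0] => // k;
  rewrite (tuple0 k) ?P0 ?eqxx.
Qed.

(** [P] and [F] live on plain sequences, so that the same functions serve at every length. *)
Lemma sum_tupleS m (P : pred (seq T)) (F : seq T -> R) :
  \sum_(k : m.+1.-tuple T | P k) F k
  = \sum_x \sum_(k : m.-tuple T | P (x :: k)) F (x :: k).
Proof.
rewrite pair_big_dep /=.
rewrite (reindex (fun p : T * m.-tuple T => cons_tuple p.1 p.2)) //.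
exists (fun k => (thead k, [tuple of behead k])) => [[x k] _|k _] /=.
  by congr (_, _); apply: val_inj.
by rewrite [RHS]tuple_eta; apply: val_inj.
Qed.

End TupleSums.

Section NestedSums.
Variables (R : fieldType) (q : R).
Hypothesis q_neq0 : q != 0.
Hypothesis q_nroot : forall k, 1 - q ^+ k.+1 != 0.

Let q1_neq0 : 1 - q != 0. Proof. exact: (q_nroot 0). Qed.

Let qnum_neq0 k : qnum q k.+1 != 0.
Proof. by rewrite mulf_neq0 ?invr_eq0. Qed.

(** * The kernel c(n,k), named [binratio], and its recurrences *)

Lemma qpochS n : qpoch q n.+1 = qpoch q n * (1 - q ^+ n.+1).
Proof. exact: big_ord_recr. Qed.

Lemma qpoch_neq0 n : qpoch q n != 0.
Proof. exact/prodf_neq0. Qed.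

Definition binratio n k : R := qbinom q n k / qbinom q (n + k) k.

Lemma binratio0 n : binratio n 0 = 1.
Proof.
rewrite /binratio addn0 divff // /qbinom.
by rewrite !mulf_neq0 ?invr_eq0 ?mulf_neq0 ?qpoch_neq0.
Qed.

Lemma binratio_gt n k : (n < k)%N -> binratio n k = 0.
Proof. by move=> nk; rewrite /binratio /qbinom leqNgt nk mul0r. Qed.

Lemma binratioE d k :
  binratio (d + k) k = qpoch q (d + k) ^+ 2 / (qpoch q d * qpoch q (d + k + k)).
Proof.
rewrite /binratio /qbinom !leq_addl !addnK; field.
by rewrite !qpoch_neq0.
Qed.

Lemma binratio_next d k :
  binratio (d + k) k.+1 * (1 - q ^+ (d + k + k.+1))
  = binratio (d + k) k * (1 - q ^+ d).
Proof.
(* At d = 0 both sides vanish, the right one through 1 - q^0. *)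
case: d => [|d]; first by rewrite binratio_gt // subrr mul0r mulr0.
rewrite binratioE addSnnS binratioE -addSnnS (addnS _ k) !qpochS; field.
by rewrite !qpoch_neq0 !q_nroot.
Qed.

Lemma binratio_prev n k : (k < n)%N ->
  binratio n k = binratio n k.+1 * (1 - q ^+ (n + k.+1)) / (1 - q ^+ (n - k)).
Proof.
move=> kn; have := binratio_next (n - k) k; rewrite subnK 1?ltnW // => ->.
by rewrite mulfK // -[(n - k)%N]prednK ?subn_gt0.
Qed.

Lemma binratio_up d k :
  binratio (d + k).+1 k * (1 - q ^+ d.+1) * (1 - q ^+ (d + k + k).+1)
  = binratio (d + k) k * (1 - q ^+ (d + k).+1) ^+ 2.
Proof.
rewrite -addSn !binratioE !addSn !qpochS; field.
by rewrite !qpoch_neq0 !q_nroot.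
Qed.

(** With N = n+1, c(n,k) / c(N,k) = (1 - q^(N-k)) (1 - q^(N+k)) / (1 - q^N)^2, and (1 - q^N)^2 - (1
    - q^(N-k)) (1 - q^(N+k)) = q^(N-k) (1 - q^k)^2. *)
Lemma binratio_diff n k : (k <= n.+1)%N ->
  binratio n.+1 k - binratio n k
  = q ^+ n.+1 * qnum q k ^+ 2 * binratio n.+1 k / (q ^+ k * qnum q n.+1 ^+ 2).
Proof.
move=> kn; apply: (canRL (mulfK _)); first by rewrite mulf_neq0 ?expf_neq0.
move: kn; rewrite leq_eqVlt => /predU1P[->|].
  by rewrite (binratio_gt (ltnSn n)); ring.
rewrite ltnS => /subnK <-; move: (n - k)%N => d.
have /(canRL (mulfK _)) -> := esym (binratio_up d k); last by rewrite expf_neq0.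
rewrite /qnum !exprS !exprD; field.
by rewrite q1_neq0 -exprD -exprS q_nroot.
Qed.

(** * Sums against the kernel: the empty word, prepending a 2 or a 1 *)

Definition ratio_sum n (G : nat -> R) : R :=
  - \sum_(1 <= k < n.+1) binratio n k * q ^+ (k ^ 2) * G k.

Fixpoint Hstar_rec (w : seq int) n : R :=
  if w is a :: w' then
    \sum_(1 <= k < n.+1) q ^+ k / qnum q k ^ a * Hstar_rec w' k
  else 1.

(** Index 0 is excluded: there the empty word gives 1, but the sum is empty. *)
Definition represents w G := forall n, Hstar_rec w n.+1 = ratio_sum n.+1 G.

Lemma ratio_sumB n G :
  ratio_sum n.+1 G - ratio_sum n G
  = - \sum_(1 <= k < n.+2)
        (binratio n.+1 k - binratio n k) * q ^+ (k ^ 2) * G k.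
Proof.
have -> : ratio_sum n G
    = - \sum_(1 <= k < n.+2) binratio n k * q ^+ (k ^ 2) * G k.
  (* The term k = n+1 can be added, since c(n,n+1) = 0. *)
  by rewrite /ratio_sum [in RHS]big_nat_recr //= binratio_gt // !mul0r addr0.
rewrite /ratio_sum -opprD -sumrB; congr (- _); apply: eq_bigr => k _.
by rewrite !mulrBl.
Qed.

(** For a nonempty word both sides vanish at n = 0, so it suffices that their increments in n
    agree. *)
Lemma represents_cons a w G G' : represents w G ->
    (forall n, ratio_sum n.+1 G' - ratio_sum n G'
               = q ^+ n.+1 / qnum q n.+1 ^ a * ratio_sum n.+1 G) ->
  represents (a :: w) G'.
Proof.
move=> wG stepG n.
suff H N : Hstar_rec (a :: w) N = ratio_sum N G' by [].
elim: N => [|N IH]; first by rewrite /ratio_sum /= !big_geq ?oppr0.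
have -> : Hstar_rec (a :: w) N.+1
  = Hstar_rec (a :: w) N + q ^+ N.+1 / qnum q N.+1 ^ a * Hstar_rec w N.+1.
  by rewrite /= big_nat_recr.
by rewrite IH wG -stepG addrC subrK.
Qed.

(* The term of Hbar for the string (0; 0), without its factor
   [binratio n k * q ^+ (k ^ 2)]. *)
Definition nil_kernel k : R :=
  (- 1) ^+ k * (1 + q ^+ k) * q ^- k * q ^- (k * k.-1 %/ 2).

Lemma half_mulS k : (k.+1 * k %/ 2 = k * k.-1 %/ 2 + k)%N.
Proof. by rewrite !divn2 -!bin2 binS bin1 addnC. Qed.

(** Lets q^(k^2) cancel against the halved exponent in [nil_kernel]. *)
Lemma sqr_half_mul k : (k ^ 2 = k + 2 * (k * k.-1 %/ 2))%N.
Proof.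
elim: k => // k IH; rewrite -addn1 sqrnD IH addn1 /= half_mulS mulnDr.
lia.
Qed.

Lemma represents_nil : represents [::] nil_kernel.
Proof.
move=> n /=.
(* [S k - S k.-1] is the k-th summand, [S n.+1 = 0] and [S 0 = 1]. *)
pose S k := (- 1) ^+ k * binratio n.+1 k * q ^+ (k + k * k.-1 %/ 2)
            * (1 - q ^+ (n.+1 - k)) / (1 - q ^+ n.+1).
have SE k : (1 <= k < n.+2)%N -> binratio n.+1 k * q ^+ (k ^ 2) * nil_kernel k
    = S k - S k.-1.
  case: k => // k /andP[_]; rewrite ltnS => kn; rewrite /S /nil_kernel /=.
  rewrite (binratio_prev kn) sqr_half_mul /= half_mulS subSS.
  rewrite -(subnKC kn) subSS; move: (n - k)%N (binratio _ _) => d c.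
  have -> : (k.+1 + d - k = d.+1)%N by lia.
  (* The denominators 1 - q^(n+1) and 1 - q^(n+1-k), in expanded form for [field]. *)
  have NE : 1 - q * q ^+ k * q ^+ d != 0 by rewrite -exprS -exprD addSn q_nroot.
  have dE : 1 - q * q ^+ d != 0 by rewrite -exprS q_nroot.
  rewrite mul2n -addnn !(exprD, exprS); field.
  by rewrite NE dE q_neq0 !expf_neq0.
rewrite /ratio_sum (eq_big_nat _ _ SE) big_add1 telescope_sumr //.
rewrite /S subnn subrr mulr0 mul0r /= binratio0 subn0 expr0.
by field.
Qed.

(** The new factor cancels the [k]^2 / q^k of [binratio_diff] term by term. *)
Lemma represents2 w G : represents w G ->
  represents (2 :: w) (fun k => q ^+ k / qnum q k ^+ 2 * G k).
Proof.
move=> /represents_cons; apply=> n.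
rewrite ratio_sumB mulrN mulr_sumr; congr (- _).
apply: eq_big_nat => -[//|k] /andP[_ kn].
rewrite binratio_diff // -exprnP; field.
by rewrite !qnum_neq0 expf_neq0.
Qed.

Definition one_kernel G k : R :=
  (q ^+ k * G k + (1 + q ^+ k) * \sum_(1 <= j < k) G j) / qnum q k.

Lemma represents1 w G : represents w G -> represents (1 :: w) (one_kernel G).
Proof.
move=> /represents_cons; apply=> n.
(* Abel summation: up to a constant, [T k.-1 - T k] is the factor of [S k.-1]
   in the summand; [T] vanishes at [n.+1] and [S] at [0]. *)
pose T k : R := binratio n.+1 k * q ^+ (k ^ 2) * (qnum q n.+1 - qnum q k).
pose S k : R := \sum_(1 <= j < k.+1) G j.
have E k : (1 <= k < n.+2)%N ->
    (binratio n.+1 k - binratio n k) * q ^+ (k ^ 2) * one_kernel G k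
    = q ^+ n.+1 / qnum q n.+1 * (binratio n.+1 k * q ^+ (k ^ 2) * G k)
      - q ^+ n.+1 / qnum q n.+1 ^+ 2 * (T k * S k - T k.-1 * S k.-1).
  case: k => // k /andP[_]; rewrite ltnS => kn; rewrite /T /S /one_kernel /=.
  rewrite binratio_diff // (binratio_prev kn) [in RHS]big_nat_recr //=.
  move: (\sum_(1 <= j < k.+1) G j) (binratio _ _) => SG c.
  rewrite -(subnKC kn) subSS; move: (n - k)%N => d.
  have -> : (k.+1 + d - k = d.+1)%N by lia.
  have -> : (k.+1 ^ 2 = k ^ 2 + k + k + 1)%N by lia.
  have NE : 1 - q * q ^+ k * q ^+ d != 0 by rewrite -exprS -exprD addSn q_nroot.
  have kE : 1 - q * q ^+ k != 0 by rewrite -exprS q_nroot.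
  have dE : 1 - q * q ^+ d != 0 by rewrite -exprS q_nroot.
  rewrite /qnum !(exprD, exprS) expr0 mulr1; field.
  by rewrite NE kE dE q_neq0 q1_neq0 !expf_neq0.
rewrite ratio_sumB mulrN (eq_big_nat _ _ E) sumrB -!mulr_sumr big_add1.
rewrite telescope_sumr // /T subrr /S (@big_geq _ _ _ 1 1.-1.+1) //.
by rewrite !(mulr0, mul0r) subrr mulr0 subr0.
Qed.

(** Only positive arguments enter the sums; at 0 identities that cancel [k] could fail. *)
Lemma eq_represents w G G' : (forall k, G k.+1 = G' k.+1) ->
  represents w G -> represents w G'.
Proof.
move=> GG' wG n; rewrite wG; congr (- _); apply: eq_big_nat => -[//|k] _.
by rewrite GG'.
Qed.

Lemma represents_nseq2 a w G : represents w G ->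
  represents (nseq a (2 : int) ++ w)
             (fun k => (q ^+ k / qnum q k ^+ 2) ^+ a * G k).
Proof.
move=> wG; elim: a => [|a IH] /=.
  by apply: eq_represents wG => k; rewrite expr0 mul1r.
apply: (eq_represents _ (represents2 IH)) => k.
by rewrite mulrA -[X in X * _ * _]expr1 -exprD.
Qed.

(** * Sums over monotone tuples as iterated sums *)

Lemma sum_ord_between N b (F : nat -> R) : (b <= N.+1)%N ->
  \sum_(x < N.+1 | (x < b)%N && (0 < x)%N) F x = \sum_(1 <= x < b) F x.
Proof.
move=> bN; rewrite big_geq_mkord (big_ord_widen_cond _ _ _ bN).
by apply: eq_bigl => x; rewrite andbC.
Qed.

(** Serves [Hstar] with [geq] and [Hbar] with [gtn]; [g] carries the extra factor in the innermost
    index. *)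
Fixpoint chain (r : rel nat) N (g : nat -> R) (f : nat -> nat -> R) m b : R :=
  if m is m'.+1 then
    \sum_(x < N.+1 | r b x && (0 < x)%N)
       f 0%N x * chain r N g (fun j => f j.+1) m' x
  else g b.

Lemma eq_chain r N g f f' m b : (forall j x, f j x = f' j x) ->
  chain r N g f m b = chain r N g f' m b.
Proof.
elim: m f f' b => //= m IH f f' b ff'; apply: eq_bigr => x _.
by rewrite ff' (IH _ (fun j => f' j.+1)).
Qed.

Lemma sum_chain (r : rel nat) N (g : nat -> R) (f : nat -> nat -> R) m b :
  \sum_(k : m.-tuple 'I_N.+1
        | path r b (map val k) && all (fun i : 'I_N.+1 => 0 < i)%N k)
     g (last b (map val k)) * \prod_(j < m) f j (nth ord0 k j)
  = chain r N g f m b.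
Proof.
elim: m f b => [|m IH] f b.
  rewrite (sum_tuple0 (fun k : seq 'I_N.+1 => path r b (map val k) && all _ k)
    (fun k => g (last b (map val k)) * \prod_(j < 0) f j (nth ord0 k j))) /=.
  by rewrite big_ord0 mulr1.
rewrite (sum_tupleS _ (fun k : seq 'I_N.+1 => path r b (map val k) && all _ k)
  (fun k => g (last b (map val k)) * \prod_(j < m.+1) f j (nth ord0 k j))) /=.
rewrite [RHS]big_mkcond; apply: eq_bigr => x _ /=.
case: (boolP (_ && _)) => [/andP[-> ->] /=|/negPf xF].
  rewrite -IH mulr_sumr; apply: eq_bigr => k _.
  by rewrite big_ord_recl mulrCA.
by rewrite big_pred0 // => k; rewrite andbACA xF.
Qed.

Lemma HstarE n s : Hstar q n s = Hstar_rec s n.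
Proof.
pose f (s : seq int) (j x : nat) : R := q ^+ x / qnum q x ^ s`_j.
have chainE b : (b <= n)%N ->
    chain geq n (fun=> 1) (f s) (size s) b = Hstar_rec s b.
  elim: s b => //= a s IH b bn; rewrite -(@sum_ord_between n) //.
  apply: eq_bigr => x /andP[xb _]; by rewrite -IH // (leq_trans _ bn).
rewrite -chainE // -sum_chain; apply: eq_big => [k|k _].
  (* All indices are at most n, so starting the path at n adds no condition. *)
  congr (_ && _); case: (tval k) => //= x k'.
  by rewrite -ltnS ltn_ord.
by rewrite mul1r; apply: eq_bigr => j _; rewrite (tnth_nth ord0).
Qed.

(** * [Hbar] as a sum against the kernel *)

Definition weight (a b : int) (k : nat) : R :=
  (1 + q ^+ k) * q ^ ((b - 1) * k%:Z) / qnum q k ^ a.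

Definition last_factor k : R := (- 1) ^+ k * q ^- (k * k.-1 %/ 2).

(** The sum over k_2 > ... > k_m below k_1 = [k]; for m = 1 the last index is [k] itself. *)
Fixpoint tail_sum (s t : seq int) k : R :=
  if s is a :: s' then
    \sum_(1 <= x < k) weight a (head 0 t) x * tail_sum s' (behead t) x
  else last_factor k.

Definition head_term (s t : seq int) k : R :=
  weight (head 0 s) (head 0 t) k * tail_sum (behead s) (behead t) k.

Lemma HbarE n s t : s != [::] ->
  Hbar q n s t
  = \sum_(1 <= k < n.+1) binratio n k * q ^+ (k ^ 2) * head_term s t k.
Proof.
case: s => // a s _; rewrite /Hbar /=.
pose f (s t : seq int) (j x : nat) : R := weight s`_j t`_j x.
have chainE b : (b <= n.+1)%N ->
    chain gtn n last_factor (f s (behead t)) (size s) b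
    = tail_sum s (behead t) b.
  elim: s (behead t) b => //= a' s IH t' b bn; rewrite -(@sum_ord_between n) //.
  apply: eq_bigr => x /andP[xb _].
  rewrite -IH; last exact: leq_trans (ltnW xb) bn.
  rewrite /f nth0; congr (_ * _); apply: eq_chain => j y.
  by rewrite nth_behead.
pose F (k : seq 'I_n.+1) : R :=
  binratio n (head ord0 k) * q ^+ (head ord0 k ^ 2) * last_factor (last ord0 k)
  * \prod_(j < (size s).+1) f (a :: s) t j (nth ord0 k j).
rewrite (eq_bigr (fun k : _.-tuple _ => F (tval k))) => [|k _]; last first.
  rewrite /F expfzDr // -exprnN -exprnP /last_factor; congr (_ * _).
    by rewrite /binratio; ring.
  by apply: eq_bigr => j _; rewrite (tnth_nth ord0).
(* Once k_1 = x is fixed, the other indices form a chain below x. *)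
rewrite (sum_tupleS _
  (fun k : seq 'I_n.+1 => sorted gtn (map val k) && all _ k) F).
rewrite -(@sum_ord_between n) // [RHS]big_mkcond; apply: eq_bigr => x _ /=.
rewrite ltn_ord /=; case: (boolP (0 < x)%N) => [x0|/negPf x0]; last first.
  by rewrite big_pred0 // => k; rewrite andbF.
rewrite /head_term -chainE -?sum_chain 1?ltnW // !mulr_sumr.
apply: eq_bigr => k _.
rewrite /F big_ord_recl /= last_map.
under eq_bigr => j _ do rewrite /f /= -nth_behead.
by rewrite {1}/f nth0 -(mulrA _ (last_factor _)) (mulrCA (last_factor _)).
Qed.

(** * The sum over the choices of separators *)

Definition string_term (s : seq nat) slast k : R :=
  \sum_(c : (size s).-tuple bool)
    head_term (circ c (rcons [seq (2 * a + 1)%N%:Z | a <- s] (2 * slast)%N%:Z))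
              (circ c (rcons [seq (a + 1)%N%:Z | a <- s] slast%:Z)) k.

Lemma weight_even a k :
  weight (2 * a)%N%:Z a%:Z k.+1
  = (q ^+ k.+1 / qnum q k.+1 ^+ 2) ^+ a * ((1 + q ^+ k.+1) * q ^- k.+1).
Proof.
rewrite /weight; move: (qnum q k.+1) (qnum_neq0 k) => y y0.
rewrite mulrBl mul1r expfzDr // -exprnN -PoszM -!exprnP mulnC !exprM.
by rewrite expr_div_n; ring.
Qed.

(** The first entry when a comma follows it: the factor of the 2's times the (1 + q^k) / [k] of
    [one_kernel]. *)
Lemma weight_odd a k :
  weight (2 * a + 1)%N%:Z (a + 1)%N%:Z k.+1
  = (q ^+ k.+1 / qnum q k.+1 ^+ 2) ^+ a * ((1 + q ^+ k.+1) / qnum q k.+1).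
Proof.
rewrite /weight; move: (qnum q k.+1) (qnum_neq0 k) => y y0.
rewrite PoszD addrK -PoszM -!exprnP (exprD y) expr1 (mulnC a) !exprM.
rewrite expr_div_n; field.
by rewrite y0 !expf_neq0.
Qed.

(** The first entry when a plus merges it into the next: the extra q^k / [k] is the other
    coefficient of [one_kernel]. *)
Lemma weight_shift a a' b' k :
  weight ((2 * a + 1)%N%:Z + a') ((a + 1)%N%:Z + b') k.+1
  = (q ^+ k.+1 / qnum q k.+1 ^+ 2) ^+ a * (q ^+ k.+1 / qnum q k.+1)
    * weight a' b' k.+1.
Proof.
rewrite /weight; move: (qnum q k.+1) (qnum_neq0 k) => y y0.
rewrite -addrA (mulrDl (a + 1)%N%:Z) !expfzDr // -PoszM -!exprnP.
rewrite (exprD y) expr1.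
rewrite (mulnC (a + 1)%N) !exprM exprD expr1 expr_div_n; field.
by rewrite y0 !expf_neq0 ?expfz_neq0.
Qed.

Lemma string_term_nil slast k :
  string_term [::] slast k.+1
  = (q ^+ k.+1 / qnum q k.+1 ^+ 2) ^+ slast * nil_kernel k.+1.
Proof.
rewrite /string_term.
rewrite (sum_tuple0 predT (fun c => head_term (circ c _) (circ c _) _)) /=.
rewrite /head_term /= weight_even /last_factor /nil_kernel.
by ring.
Qed.

Lemma circ_neq0 c x : x != [::] -> circ c x != [::].
Proof. by case: c x => [|[] c] [|a x]. Qed.

Lemma tail_sumE s t k : s != [::] ->
  tail_sum s t k = \sum_(1 <= j < k) head_term s t j.
Proof. by case: s. Qed.

Lemma string_term_cons a s slast k :
  string_term (a :: s) slast k.+1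
  = (q ^+ k.+1 / qnum q k.+1 ^+ 2) ^+ a * one_kernel (string_term s slast) k.+1.
Proof.
rewrite /string_term /=.
pose x := rcons [seq (2 * b + 1)%N%:Z | b <- s] (2 * slast)%N%:Z.
pose t := rcons [seq (b + 1)%N%:Z | b <- s] slast%:Z.
rewrite (sum_tupleS _ predT
  (fun c => head_term (circ c ((2 * a + 1)%N%:Z :: x))
                      (circ c ((a + 1)%N%:Z :: t)) _)) /= big_bool /=.
have tailE c : tail_sum (circ c x) (circ c t) k.+1
    = \sum_(1 <= j < k.+1) head_term (circ c x) (circ c t) j.
  by rewrite tail_sumE // circ_neq0 // -size_eq0 size_rcons.
rewrite /one_kernel exchange_big /= mulrDl mulrDr addrC.
rewrite !mulr_sumr !mulr_suml !mulr_sumr.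
congr (_ + _); apply: eq_bigr => c _; rewrite /head_term /=.
  by rewrite weight_shift; ring.
by rewrite weight_odd tailE; ring.
Qed.

Lemma represents_string s slast :
  represents (flatten [seq rcons (nseq a (2 : int)) 1 | a <- s]
              ++ nseq slast (2 : int))
             (string_term s slast).
Proof.
elim: s => [|a s IH] /=.
  rewrite -[nseq _ _]cats0.
  apply: eq_represents (represents_nseq2 _ represents_nil) => k.
  by rewrite string_term_nil.
rewrite -catA cat_rcons.
apply: eq_represents (represents_nseq2 _ (represents1 IH)) => k.
by rewrite string_term_cons.
Qed.

End NestedSums.

(* MathComp. [s] is (s_1, ..., s_m) and [slast] is s_{m+1}. *)
Theorem theorem3p3 (R : realFieldType) (q : R) (hq : 0 < q < 1)
    (m : nat) (s : m.-tuple nat) (slast : nat) (hslast : (0 < slast)%N)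
    (n : nat) (hn : (0 < n)%N) :
  Hstar q n (flatten [seq rcons (nseq a (2 : int)) 1 | a <- s]
             ++ nseq slast (2 : int))
  = - \sum_(c : m.-tuple bool)
        Hbar q n
          (circ c (rcons [seq (2 * a + 1)%N%:Z | a <- s] (2 * slast)%N%:Z))
          (circ c (rcons [seq (a + 1)%N%:Z | a <- s] slast%:Z)).
Proof.
case/andP: hq => q0 q1.
have q_neq0 : q != 0 by rewrite gt_eqF.
have q_nroot k : 1 - q ^+ k.+1 != 0.
  by rewrite subr_eq0 gt_eqF // exprn_ilt1 // ltW.
case: s => s /= /eqP sm; subst m; case: n hn => // n _.
rewrite HstarE represents_string //; congr (- _).
(* The final entry keeps every string nonempty, so the clause for m = 0 in [Hbar] never applies. *)
have circP (c : (size s).-tuple bool) :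
    circ c (rcons [seq (2 * a + 1)%N%:Z | a <- s] (2 * slast)%N%:Z) != [::].
  by rewrite circ_neq0 // -size_eq0 size_rcons.
(* With the sum over [k] outside, the inner sum over [c] is [string_term]. *)
rewrite (eq_bigr _ (fun c _ => HbarE q_neq0 _ _ (circP c))) exchange_big /=.
by apply: eq_bigr => k _; rewrite -mulr_sumr.
Qed.
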